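(* Let $(\mathbf{Base},X)$ be an optimization domain and let $(l, -R[l]_1, s, \tau)$ be a generalized gradient flow over $(\mathbf{Base},X)$ with state space $A$ (and dimension $1$). For every $t\in\tau$, \[ D_1[l\circ\pi_0\circ s]\circ t \;=\; -R[l]_{s_t}^{\dagger}\circ R[l]_{s_t}\circ 1_X \;:\; *\to X, \] where $R[l]_{s_t} = R[l]\circ\langle s\circ t\circ !_X, id_X\rangle : X\to A$, and $\pi_0: A^1 \to A$ is the identity.
   Context: Cartesian left additive category: a category $\mathbf{C}$ with finite products (terminal object $*$, unique maps $!_A : A \to *$, projections $\pi_0,\pi_1$, pairing $\langle -,-\rangle$) in which every hom-set $\mathbf{C}[B,C]$ is a commutative monoid $(+, 0_{BC})$ such that $(f+g)\circ h = (f\circ h)+(g\circ h)$, $0_{BC}\circ h = 0_{AC}$ for all $h: A \to B$, and $\pi_i\circ(f+g) = (\pi_i\circ f)+(\pi_i\circ g)$, $\pi_i \circ 0 = 0$ for all projections $\pi_i$. Write $\iota_0 = \langle 1, 0\rangle : A \to A\times B$ and $\iota_1 = \langle 0, 1\rangle : B \to A \times B$. $A^k$ denotes the $k$-fold product. Cartesian reverse derivative category: a Cartesian left additive category with a combinator $R$ assigning to each $f: A \to B$ a morphism $R[f]: A\times B \to A$ such that RD.1: $R[f+g]=R[f]+R[g]$, $R[0]=0$; RD.2: $R[f]\circ\langle a,b+c\rangle = R[f]\circ\langle a,b\rangle + R[f]\circ\langle a,c\rangle$, $R[f]\circ\langle a,0\rangle=0$; RD.3: $R[1]=\pi_1$,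 $R[\pi_0]=\iota_0\circ\pi_1$, $R[\pi_1]=\iota_1\circ\pi_1$; RD.4: $R[\langle f,g\rangle]=R[f]\circ(1\times\pi_0)+R[g]\circ(1\times\pi_1)$, $R[!_A]=0$; RD.5: $R[g\circ f]=R[f]\circ(1\times R[g])\circ\langle\pi_0,\langle f\circ\pi_0,\pi_1\rangle\rangle$; RD.6: $\pi_1\circ R[R[R[f]]]\circ(\iota_0\times 1)\circ\langle 1\times\pi_0, 0\times\pi_1\rangle = R[f]\circ(1\times\pi_1)$; RD.7: with $D[f] := \pi_1\circ R[R[f]]\circ(\iota_0\times 1) : A \times A \to B$, one has $D[D[f]] = D[D[f]]\circ\langle\pi_0\times\pi_0,\pi_1\times\pi_1\rangle$. In such a category $D$ is called the Cartesian derivative combinator; it makes the category a Cartesian differential category (in particular $D[g\circ f]=D[g]\circ\langle f\circ\pi_0, D[f]\rangle$ and $D[f]$ is additive in its second argument). A morphism $f : A \to B$ is linear if $D[f]=f\circ\pi_1$. Linear maps form a subcategory with an identity-on-objects contravariant involution $f\mapsto f^\dagger$ (a linear $f:A\to B$ gives a linear $f^\dagger: B\to A$) characterised by $R[f]=f^\dagger\circ\pi_1$ for linear $f$. (The maps $R[l]\circ\langle a\circ !_X, id_X\rangle: X \to A$ with $a: * \to A$ are linear, so the dagger in the claim makes sense.) Optimization domain $(\mathbf{Base},X)$: $\mathbf{Base}$ is a Cartesian reverse derivative category in which every morphism $f$ has an additive inverse $-f$, and each hom-set $\mathbf{Base}[*,A]$ carries a multiplication and a multiplicative identity $1_A : *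 \to A$ making it, with $+$, a commutative ring; $X$ is an object of $\mathbf{Base}$ such that $\mathbf{Base}[*,X]$ is further equipped with a total order making it an ordered commutative ring. An objective is a morphism $l: A\to X$. Write $1_{AB} = 1_B\circ !_A : A \to B$. Generalized gradient of $l: A \to X$: $R[l]_1 = R[l]\circ\langle id_A, 1_{AX}\rangle : A\to A$. Generalized derivative of $f: X\to A$: $D_1[f] = D[f]\circ\langle id_X, 1_{XX}\rangle : X\to A$. Generalized optimization flow over $(\mathbf{Base},X)$ with state space $A$ and dimension $k$: a tuple $(l,d,s,\tau)$ where $l: A\to X$ is an objective, $d: A^k\to A^k$ and $s: X\to A^k$ are morphisms of $\mathbf{Base}$, and $\tau$ is an interval in the ordered set $\mathbf{Base}[*,X]$ such that $d\circ s\circ t = D_1[s]\circ t : *\to A^k$ for all $t\in\tau$. A generalized gradient flow is one of the form $(l,-R[l]_1,s,\tau)$ (so $k=1$). *)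

(* Defs.v *)
(* MathComp's algebraic interfaces are not used for hom-sets because they
   would additionally require every hom-set to be a choiceType (and its ordered
   rings to be integral domains); only the ssrfun algebraic predicates are
   borrowed. *)
From mathcomp Require Import ssreflect ssrfun.

Set Implicit Arguments.
Unset Strict Implicit.
Unset Printing Implicit Defensive.

Declare Scope rdc_scope.
Delimit Scope rdc_scope with rdc.
Local Open Scope rdc_scope.

Record category := Category {
  obj :> Type;
  hom : obj -> obj -> Type;
  idm : forall A, hom A A;
  comp : forall A B C, hom B C -> hom A B -> hom A C;
  compA : forall A B C D (h : hom C D) (g : hom B C) (f : hom A B),
    comp h (comp g f) = comp (comp h g) f;
  comp1m : forall A B (f : hom A B), comp (idm B) f = f;
  compm1 : forall A B (f : hom A B), comp f (idm A) = f }.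

Arguments hom {_} _ _.
Arguments idm {_} A.
Notation "g \c f" := (comp g f) (at level 40, left associativity) : rdc_scope.

Record cartesian_category := CartesianCategory {
  cart_cat :> category;
  term : cart_cat;
  bang : forall A : cart_cat, hom A term;
  bang_uniq : forall (A : cart_cat) (f : hom A term), f = bang A;
  prod : cart_cat -> cart_cat -> cart_cat;
  pi0 : forall A B : cart_cat, hom (prod A B) A;
  pi1 : forall A B : cart_cat, hom (prod A B) B;
  pair : forall C A B : cart_cat, hom C A -> hom C B -> hom C (prod A B);
  pi0_pair : forall (C A B : cart_cat) (f : hom C A) (g : hom C B),
    pi0 A B \c pair f g = f;
  pi1_pair : forall (C A B : cart_cat) (f : hom C A) (g : hom C B),
    pi1 A B \c pair f g = g;
  pair_uniq : forall (C A B : cart_cat) (f : hom C A) (g : hom C B)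
    (h : hom C (prod A B)), pi0 A B \c h = f -> pi1 A B \c h = g -> h = pair f g }.

Arguments term {_}.
Arguments bang {_} A.
Arguments pi0 {_ A B}.
Arguments pi1 {_ A B}.
Notation "<| f , g |>" := (pair f g)
  (at level 0, f at level 99, g at level 99) : rdc_scope.

Definition prodm (C : cartesian_category) (A B A' B' : C)
  (f : hom A A') (g : hom B B') : hom (prod A B) (prod A' B') :=
  <| f \c pi0, g \c pi1 |>.
Notation "f >< g" := (prodm f g) (at level 35, no associativity) : rdc_scope.

(* A^0 is terminal and A^1 is A on the nose, so that the projection A^1 -> A
   is the identity. *)
Fixpoint pow (C : cartesian_category) (A : C) (k : nat) : C :=
  match k with
  | O => term
  | S k' => match k' with O => A | S _ => prod A (pow A k') end
  end.

Definition pow_pi0 (C : cartesian_category) (A : C) (k : nat) :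
    hom (pow A (S k)) A :=
  match k return hom (pow A (S k)) A with O => idm A | S _ => pi0 end.
Arguments pow_pi0 {_} A k.

Record cartesian_left_additive_category := CartesianLeftAdditiveCategory {
  clac_cart :> cartesian_category;
  add : forall A B : clac_cart, hom A B -> hom A B -> hom A B;
  zero : forall A B : clac_cart, hom A B;
  addA : forall A B : clac_cart, associative (@add A B);
  addC : forall A B : clac_cart, commutative (@add A B);
  add0m : forall A B : clac_cart, left_id (zero A B) (@add A B);
  compDl : forall (A B C : clac_cart) (f g : hom B C) (h : hom A B),
    add f g \c h = add (f \c h) (g \c h);
  comp0l : forall (A B C : clac_cart) (h : hom A B), zero B C \c h = zero A C;
  pi0D : forall (C A B : clac_cart) (f g : hom C (prod A B)),
    pi0 \c add f g = add (pi0 \c f) (pi0 \c g);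
  pi1D : forall (C A B : clac_cart) (f g : hom C (prod A B)),
    pi1 \c add f g = add (pi1 \c f) (pi1 \c g);
  pi00 : forall C A B : clac_cart, pi0 \c zero C (prod A B) = zero C A;
  pi10 : forall C A B : clac_cart, pi1 \c zero C (prod A B) = zero C B }.

Arguments zero {_} A B.
Notation "f + g" := (add f g) : rdc_scope.
Notation "0" := (zero _ _) : rdc_scope.

Definition iota0 (C : cartesian_left_additive_category) (A B : C) :
  hom A (prod A B) := <| idm A, 0 |>.
Definition iota1 (C : cartesian_left_additive_category) (A B : C) :
  hom B (prod A B) := <| 0, idm B |>.
Arguments iota0 {_ A B}.
Arguments iota1 {_ A B}.

(* The Cartesian derivative D[f] induced by a reverse combinator R; it is
   needed before the structure below is formed, as the last axiom uses it. *)
Definition deriv_of (C : cartesian_left_additive_category)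
  (R : forall A B : C, hom A B -> hom (prod A B) A)
  (A B : C) (f : hom A B) : hom (prod A A) B :=
  pi1 \c R _ _ (R _ _ f) \c (iota0 >< idm A).

Record cartesian_reverse_derivative_category :=
    CartesianReverseDerivativeCategory {
  crdc_clac :> cartesian_left_additive_category;
  rd : forall A B : crdc_clac, hom A B -> hom (prod A B) A;
  RD1D : forall (A B : crdc_clac) (f g : hom A B), rd (f + g) = rd f + rd g;
  RD10 : forall A B : crdc_clac, rd (zero A B) = 0;
  RD2D : forall (C A B : crdc_clac) (f : hom A B) (a : hom C A) (b c : hom C B),
    rd f \c <| a, b + c |> = rd f \c <| a, b |> + rd f \c <| a, c |>;
  RD20 : forall (C A B : crdc_clac) (f : hom A B) (a : hom C A),
    rd f \c <| a, 0 |> = 0;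
  RD3id : forall A : crdc_clac, rd (idm A) = pi1;
  RD3pi0 : forall A B : crdc_clac, rd (@pi0 _ A B) = iota0 \c pi1;
  RD3pi1 : forall A B : crdc_clac, rd (@pi1 _ A B) = iota1 \c pi1;
  RD4pair : forall (C A B : crdc_clac) (f : hom C A) (g : hom C B),
    rd <| f, g |> = rd f \c (idm C >< pi0) + rd g \c (idm C >< pi1);
  RD4bang : forall A : crdc_clac, rd (bang A) = 0;
  RD5 : forall (A B C : crdc_clac) (f : hom A B) (g : hom B C),
    rd (g \c f) =
    rd f \c (idm A >< rd g) \c <| pi0, <| f \c pi0, pi1 |> |>;
  RD6 : forall (A B : crdc_clac) (f : hom A B),
    pi1 \c rd (rd (rd f)) \c (iota0 >< idm (prod A B))
      \c <| idm A >< @pi0 _ B B, zero A A >< @pi1 _ B B |>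
    = rd f \c (idm A >< pi1);
  RD7 : forall (A B : crdc_clac) (f : hom A B),
    deriv_of rd (deriv_of rd f) =
    deriv_of rd (deriv_of rd f) \c <| pi0 >< pi0, pi1 >< pi1 |> }.

Notation "R[ f ]" := (rd f)
  (at level 0, f at level 99, format "R[ f ]") : rdc_scope.

Definition deriv (C : cartesian_reverse_derivative_category) (A B : C)
  (f : hom A B) : hom (prod A A) B := deriv_of (@rd C) f.
Notation "D[ f ]" := (deriv f)
  (at level 0, f at level 99, format "D[ f ]") : rdc_scope.

Definition linear (C : cartesian_reverse_derivative_category) (A B : C)
  (f : hom A B) : Prop := D[f] = f \c pi1.

(* Only meaningful for linear f; see daggerP and dagger_uniq, which show that
   it is then the unique g with R[f] = g o pi1. *)
Definition dagger (C : cartesian_reverse_derivative_category) (A B : C)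
  (f : hom A B) : hom B A := R[f] \c iota1.

(* R[f]_a for a point a *)
Definition rd_at (C : cartesian_reverse_derivative_category) (A B : C)
  (f : hom A B) (a : hom term A) : hom B A :=
  R[f] \c <| a \c bang B, idm B |>.

(* The pair (Base, X), with X = optX. The additive group of each ring Base[*,A]
   is that of the hom-set. *)
Record optimization_domain := OptimizationDomain {
  base :> cartesian_reverse_derivative_category;
  opp : forall A B : base, hom A B -> hom A B;
  addNm : forall (A B : base) (f : hom A B), opp f + f = 0;
  pmul : forall A : base, hom term A -> hom term A -> hom term A;
  pone : forall A : base, hom term A;
  pmulA : forall A : base, associative (@pmul A);
  pmulC : forall A : base, commutative (@pmul A);
  pmul1 : forall A : base, left_id (pone A) (@pmul A);
  pmulDl : forall A : base, left_distributive (@pmul A) (@add _ term A);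
  optX : base;
  ple : hom term optX -> hom term optX -> Prop;
  ple_refl : forall a, ple a a;
  ple_anti : forall a b, ple a b -> ple b a -> a = b;
  ple_trans : forall a b c, ple a b -> ple b c -> ple a c;
  ple_total : forall a b, ple a b \/ ple b a;
  ple_add : forall a b c, ple a b -> ple (a + c) (b + c);
  ple_mul : forall a b, ple 0 a -> ple 0 b -> ple 0 (pmul a b) }.

Arguments pone {_} A.
Arguments optX {_}.
Notation "- f" := (opp f) : rdc_scope.

(* 1_{AB} : A -> B *)
Definition onem (Base : optimization_domain) (A B : Base) : hom A B :=
  pone B \c bang A.
Arguments onem {_} A B.

(* The generalized gradient R[l]_1 *)
Definition ggrad (Base : optimization_domain) (A : Base) (l : hom A optX) :
  hom A A := R[l] \c <| idm A, onem A optX |>.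

(* The generalized derivative D_1[f] *)
Definition gderiv (Base : optimization_domain) (A : Base) (f : hom optX A) :
  hom optX A := D[f] \c <| idm optX, onem optX optX |>.

Definition is_interval (Base : optimization_domain)
  (tau : hom (@term Base) optX -> Prop) : Prop :=
  forall a b c, tau a -> tau b -> ple a c -> ple c b -> tau c.

Definition is_optimization_flow (Base : optimization_domain) (A : Base) (k : nat)
  (l : hom A optX) (d : hom (pow A k) (pow A k)) (s : hom optX (pow A k))
  (tau : hom (@term Base) optX -> Prop) : Prop :=
  is_interval tau /\ forall t, tau t -> d \c s \c t = gderiv s \c t.
Arguments is_optimization_flow {_} A k l d s tau.

Definition is_gradient_flow (Base : optimization_domain) (A : Base)
  (l : hom A optX) (s : hom optX (pow A 1))
  (tau : hom (@term Base) optX -> Prop) : Prop :=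
  is_optimization_flow A 1 l (- ggrad l) s tau.
Arguments is_gradient_flow {_} A l s tau.

(* The rest shows that [dagger] is the operation characterised by
   R[f] = f^dagger o pi1 on linear maps (daggerP, dagger_uniq), and that the
   maps [rd_at f a] are linear (rd_at_linear). *)

Lemma pair_comp (C : cartesian_category) (D E A B : C) (f : hom E A)
  (g : hom E B) (h : hom D E) : <| f, g |> \c h = <| f \c h, g \c h |>.
Proof. by apply: pair_uniq; rewrite compA ?pi0_pair ?pi1_pair. Qed.

Lemma pair_eta (C : cartesian_category) (D A B : C) (h : hom D (prod A B)) :
  h = <| pi0 \c h, pi1 \c h |>.
Proof. exact: pair_uniq. Qed.

Lemma prodm_pair (C : cartesian_category) (D A B A' B' : C) (f : hom A A')
  (g : hom B B') (a : hom D A) (b : hom D B) :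
  (f >< g) \c <| a, b |> = <| f \c a, g \c b |>.
Proof. by rewrite /prodm pair_comp -!compA pi0_pair pi1_pair. Qed.

Ltac simp := rewrite ?/prodm; repeat progress rewrite -?compA ?pair_comp
  ?pi0_pair ?pi1_pair ?comp1m ?compm1 ?comp0l ?pi00 ?pi10.

Section Additive.
Context {C : cartesian_left_additive_category}.

Lemma addm0 (A B : C) (f : hom A B) : f + 0 = f.
Proof. by rewrite addC add0m. Qed.

Lemma iota0E (D A B : C) (h : hom D A) : @iota0 C A B \c h = <| h, 0 |>.
Proof. by rewrite /iota0 pair_comp comp1m comp0l. Qed.

Lemma iota1E (D A B : C) (h : hom D B) : @iota1 C A B \c h = <| 0, h |>.
Proof. by rewrite /iota1 pair_comp comp1m comp0l. Qed.

End Additive.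

Section Reverse.
Context {C : cartesian_reverse_derivative_category}.

Lemma rd_comp (D A B E : C) (f : hom A B) (g : hom B E) (a : hom D A)
  (c : hom D E) : R[g \c f] \c <| a, c |> = R[f] \c <| a, R[g] \c <| f \c a, c |> |>.
Proof.
by rewrite RD5; simp.
Qed.

Lemma rd_pair (D A B E : C) (f : hom A B) (g : hom A E) (a : hom D A)
  (c : hom D (prod B E)) : R[<| f, g |>] \c <| a, c |> =
  R[f] \c <| a, pi0 \c c |> + R[g] \c <| a, pi1 \c c |>.
Proof. by rewrite RD4pair compDl -!compA !prodm_pair comp1m. Qed.

Lemma rd_pi0 (D A B : C) (a : hom D (prod A B)) (c : hom D A) :
  R[pi0] \c <| a, c |> = <| c, 0 |>.
Proof. by rewrite RD3pi0 -compA pi1_pair iota0E. Qed.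

Lemma rd_pi1 (D A B : C) (a : hom D (prod A B)) (c : hom D B) :
  R[pi1] \c <| a, c |> = <| 0, c |>.
Proof. by rewrite RD3pi1 -compA pi1_pair iota1E. Qed.

Lemma rd_id (D A : C) (a c : hom D A) : R[idm A] \c <| a, c |> = c.
Proof. by rewrite RD3id pi1_pair. Qed.

Lemma derivE (D A B : C) (f : hom A B) (a b : hom D A) :
  D[f] \c <| a, b |> = pi1 \c R[R[f]] \c <| <| a, 0 |>, b |>.
Proof. by rewrite /deriv /deriv_of -compA prodm_pair comp1m iota0E. Qed.

Lemma deriv_rd (D A B : C) (f : hom A B) (a : hom D A) (b d : hom D B) :
  D[R[f]] \c <| <| a, b |>, <| 0, d |> |> = R[f] \c <| a, d |>.
Proof.
have := congr1 (fun h => h \c <| a, <| b, d |> |>) (RD6 f).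
by simp; rewrite compA -derivE.
Qed.

(* pi1 o R[D[f]] at ((a,0),c) is R[f](a,c); when D[f] = f o pi1 it is also
   R[f](0,c). *)
Lemma rd_deriv (D A B : C) (f : hom A B) (a : hom D A) (c : hom D B) :
  pi1 \c R[D[f]] \c <| <| a, 0 |>, c |> = R[f] \c <| a, c |>.
Proof.
rewrite -(deriv_rd f a 0 c) derivE.
rewrite /deriv /deriv_of -!compA !rd_comp -!compA rd_pi1.
rewrite !prodm_pair comp1m iota0E.
set z := R[R[R[f]]] \c _.
rewrite /prodm rd_pair pi1D !rd_comp rd_pi0 rd_pi1 rd_id pi1_pair pi1_pair.
by rewrite add0m.
Qed.

Lemma daggerP (A B : C) (f : hom A B) : linear f -> R[f] = dagger f \c pi1.
Proof.
move=> lf; rewrite /dagger -compA iota1E.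
have E (c : hom (prod A B) B) (a : hom (prod A B) A) :
    R[f] \c <| a, c |> = R[f] \c <| 0, c |>.
  by rewrite -(rd_deriv f a c) lf -compA rd_comp rd_pi1 !pi1_pair.
rewrite -(E pi1 pi0) -[LHS]compm1; congr (_ \c _).
by rewrite [LHS]pair_eta !compm1.
Qed.

Lemma dagger_uniq (A B : C) (f : hom A B) (g : hom B A) :
  R[f] = g \c pi1 -> g = dagger f.
Proof. by move=> Rf; rewrite /dagger Rf -compA pi1_pair compm1. Qed.

Lemma deriv_comp (D A B E : C) (f : hom A B) (g : hom B E) (a b : hom D A) :
  D[g \c f] \c <| a, b |> = D[g] \c <| f \c a, D[f] \c <| a, b |> |>.
Proof.
have rgf : R[g \c f] = R[f] \c <| pi0, R[g] \c <| f \c pi0, pi1 |> |>.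
  rewrite -rd_comp -[LHS]compm1; congr (_ \c _).
  by rewrite [LHS]pair_eta !compm1.
rewrite !derivE rgf -!compA rd_comp !pair_comp pi0_pair.
rewrite -!compA !pair_comp -!compA pi0_pair pi1_pair RD20.
set y := R[R[f]] \c _.
rewrite rd_pair pi1D rd_pi0 pi1_pair add0m rd_comp.
rewrite !pair_comp -!compA pi0_pair pi1_pair.
set z := R[R[g]] \c _.
by rewrite rd_pair pi1D rd_comp rd_pi0 rd_pi1 !pi1_pair add0m.
Qed.

Lemma deriv_pair (D A B E : C) (f : hom A B) (g : hom A E) (a b : hom D A) :
  D[<| f, g |>] \c <| a, b |> = <| D[f] \c <| a, b |>, D[g] \c <| a, b |> |>.
Proof.
have rfg : R[<| f, g |>] = R[f] \c <| pi0, pi0 \c pi1 |> + R[g] \c <| pi0, pi1 \c pi1 |>.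
  by rewrite RD4pair /prodm !comp1m.
rewrite !derivE rfg RD1D -!compA compDl pi1D !rd_comp.
rewrite !pair_comp -!compA !pi0_pair !pi1_pair pi00 pi10.
rewrite !rd_pair !pi1D !rd_pi0 !pi1_pair !add0m !rd_comp !pi1_pair !rd_pi0 !rd_pi1 !pi1_pair.
apply: pair_uniq; rewrite ?pi0D ?pi1D ?pi0_pair ?pi1_pair.
  by rewrite addm0.
by rewrite add0m.
Qed.

Lemma deriv_id (D A : C) (a b : hom D A) : D[idm A] \c <| a, b |> = b.
Proof. by rewrite derivE RD3id -compA rd_pi1 pi1_pair. Qed.

Lemma deriv_const (D A B : C) (p : hom term B) (a b : hom D A) :
  D[p \c bang A] \c <| a, b |> = 0.
Proof.
have -> : bang A = zero A term by rewrite [RHS]bang_uniq.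
rewrite deriv_comp (_ : <| _ , _ |> = <| zero A term \c a, 0 |>); last first.
  by congr <| _, _ |>; rewrite [LHS]bang_uniq [RHS]bang_uniq.
by rewrite derivE -compA RD20 pi10.
Qed.

Lemma rd_at_linear (A B : C) (f : hom A B) (a : hom term A) : linear (rd_at f a).
Proof.
have E : D[rd_at f a] \c <| pi0, pi1 |> = rd_at f a \c pi1.
  rewrite /rd_at deriv_comp deriv_pair deriv_const deriv_id.
  rewrite pair_comp deriv_rd; simp; congr (_ \c <| _ \c _, _ |>).
  by rewrite [LHS]bang_uniq [RHS]bang_uniq.
rewrite /linear -E -[LHS]compm1; congr (_ \c _).
by rewrite [LHS]pair_eta !compm1.
Qed.

End Reverse.

(* Main.v *)
(** The chain rule together with the flow equation rewrites the left-hand side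
    as [D[l] (s t, - R[l] (s t, 1))].  The adjoint of [R[l]_a] is the
    directional derivative [D[l] (a, -)], and [D[l]] commutes with negation in
    its second argument because [R[R[l]]] is additive there. *)
From mathcomp Require Import ssreflect ssrfun.
Require Import Defs.
Local Open Scope rdc_scope.

Section ReverseDerivative.
Context {C : cartesian_reverse_derivative_category}.

Lemma bang_comp (A B : C) (f : hom A B) : bang B \c f = bang A.
Proof. exact: bang_uniq. Qed.

Lemma bang_term : bang (@term C) = idm term.
Proof. by rewrite [RHS]bang_uniq. Qed.

Lemma deriv_addr (D A B : C) (f : hom A B) (a b c : hom D A) :
  D[f] \c <| a, b + c |> = D[f] \c <| a, b |> + D[f] \c <| a, c |>.
Proof. by rewrite !derivE -!compA RD2D pi1D. Qed.

Lemma deriv_zeror (D A B : C) (f : hom A B) (a : hom D A) :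
  D[f] \c <| a, 0 |> = 0.
Proof. by rewrite derivE -compA RD20 pi10. Qed.

Lemma rd_const (D A B : C) (p : hom term B) (a : hom D A) (c : hom D B) :
  R[p \c bang A] \c <| a, c |> = 0.
Proof. by rewrite rd_comp RD4bang comp0l. Qed.

(** The constant component of the pairing in [rd_at] has zero reverse derivative and the identity
    component passes its input through. What remains is the second projection of [R[R[f]]] at [a]
    paired with 0, the formula of [derivE]. *)
Lemma dagger_rd_at (D A B : C) (f : hom A B) (a : hom term A) (y : hom D A) :
  dagger (rd_at f a) \c y = D[f] \c <| a \c bang D, y |>.
Proof.
rewrite /dagger -compA iota1E /rd_at rd_comp rd_pair rd_const rd_id add0m.
by rewrite derivE pair_comp comp1m -!compA bang_comp.
Qed.

End ReverseDerivative.

Section Opposite.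
Context {Base : optimization_domain}.

(** No axiom relates negation to composition or to [D]; uniqueness of inverses reduces such laws to
    exhibiting a zero sum. *)
Lemma opp_uniq (A B : Base) (f g : hom A B) : f + g = 0 -> f = - g.
Proof.
by move=> fg0; rewrite -[LHS]addm0 -(addNm g) [- g + g]addC addA fg0 add0m.
Qed.

Lemma opp_comp (A B D : Base) (f : hom B D) (h : hom A B) :
  (- f) \c h = - (f \c h).
Proof. by apply: opp_uniq; rewrite -compDl addNm comp0l. Qed.

Lemma deriv_oppr (D A B : Base) (f : hom A B) (a b : hom D A) :
  D[f] \c <| a, - b |> = - (D[f] \c <| a, b |>).
Proof. by apply: opp_uniq; rewrite -deriv_addr addNm deriv_zeror. Qed.

Lemma gderiv_at (A : Base) (f : hom optX A) (t : hom term optX) :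
  gderiv f \c t = D[f] \c <| t, pone optX |>.
Proof.
by rewrite /gderiv -compA pair_comp comp1m /onem -compA bang_comp bang_term compm1.
Qed.

(** Both sides are [R[l]] at the pair of [a] and 1: the gradient fixes the 1 and varies the base
    point, [rd_at] does the opposite. *)
Lemma ggrad_at (A : Base) (l : hom A optX) (a : hom term A) :
  ggrad l \c a = rd_at l a \c pone optX.
Proof.
rewrite /ggrad /rd_at /onem -!compA !pair_comp !comp1m -!compA !bang_comp.
by rewrite bang_term !compm1.
Qed.

End Opposite.

Theorem proposition4 (Base : optimization_domain) (A : Base) (l : hom A optX)
    (s : hom optX (pow A 1)) (tau : hom (@term Base) optX -> Prop) :
  is_gradient_flow A l s tau ->
  forall t : hom (@term Base) optX, tau t ->
    gderiv (l \c pow_pi0 A 0 \c s) \c t =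
    - (dagger (rd_at l (s \c t)) \c rd_at l (s \c t) \c pone optX).
Proof.
move=> [_ flow] t /flow {flow}.
rewrite !gderiv_at opp_comp opp_comp -compA ggrad_at => flow.
(* Moving the sign inside [D[l]] exposes the negated gradient at [s \c t], which [flow] replaces by
   the derivative of [s]. *)
rewrite -[_ \c _ \c pone _]compA dagger_rd_at bang_term compm1 -deriv_oppr flow.
(* [pow_pi0 A 0] computes to the identity, leaving the chain rule for [l \c s]. *)
by rewrite /= compm1 deriv_comp.
Qed.
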